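(* For all integers $n>1$, \[3\log_3 n \leq \|n\|_{-} \leq 6\log_6 n + 5.890 < 3.679\log_3 n + 5.890.\] Moreover, if $n$ is a power of $3$ then $\|n\|_{-} = 3\log_3 n$, and otherwise $\|n\|_{-} > 3\log_3 n$.
   Context: For a positive integer $m$, $\|m\|_{-}$ denotes the minimum number of occurrences of the constant $1$ in an arithmetic expression built only from the constant $1$, addition, multiplication, subtraction and parentheses (the basis $\{1,+,\cdot,-\}$) whose value is $m$. *)

(* Defs.v *)
From Stdlib Require Import ZArith Lia Reals Classical ClassicalEpsilon Wf_nat.

(* Expressions over the basis {1, +, *, -}; subtraction is binary, and
   subexpressions may take any integer value, including 0 and negatives. *)
Inductive expr : Set :=
| One : expr
| Add : expr -> expr -> expr
| Mul : expr -> expr -> expr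
| Sub : expr -> expr -> expr.

Fixpoint eval (e : expr) : Z :=
  match e with
  | One => 1
  | Add a b => eval a + eval b
  | Mul a b => eval a * eval b
  | Sub a b => eval a - eval b
  end%Z.

Fixpoint ones (e : expr) : nat :=
  match e with
  | One => 1
  | Add a b | Mul a b | Sub a b => ones a + ones b
  end%nat.

Definition is_complexity (m : Z) (k : nat) : Prop :=
  (exists e, eval e = m /\ ones e = k) /\
  (forall e, eval e = m -> (k <= ones e)%nat).

Lemma eval_surj (m : Z) : exists e, eval e = m.
Proof.
assert (Hpos : forall j : nat, exists e, eval e = Z.of_nat j).
{ induction j as [|j [e He]].
  - now exists (Sub One One).
  - exists (Add e One). simpl eval. rewrite He. lia. }
destruct (Hpos (Z.to_nat m)) as [a Ha].
destruct (Hpos (Z.to_nat (- m))) as [b Hb].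
exists (Sub a b). simpl eval. rewrite Ha, Hb. lia.
Qed.

Lemma complexity_exists (m : Z) : exists k, is_complexity m k.
Proof.
destruct (eval_surj m) as [e0 He0].
destruct (dec_inh_nat_subset_has_unique_least_element
            (fun k => exists e, eval e = m /\ ones e = k))
  as [k [[Hk Hmin] _]].
- intro k. apply classic.
- now exists (ones e0), e0.
- exists k. split; [exact Hk|].
  intros e He. apply Hmin. now exists e.
Qed.

Definition complexity (m : Z) : nat :=
  proj1_sig (constructive_indefinite_description _ (complexity_exists m)).

Lemma complexityP (m : Z) : is_complexity m (complexity m).
Proof.
exact (proj2_sig (constructive_indefinite_description _ (complexity_exists m))).
Qed.

(* Main.v *)
Require Import Defs.
From Stdlib Require Import ZArith Reals.
From Stdlib Require Import Lia Lra Znumtheory.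
Open Scope R_scope.

(** Lower bound: an expression with [k] ones satisfies [|value|^3 <= 3^k], and
    [n^3 = 3^k] forces [n] to be a power of [3].

    Upper bound: every [n >= 4] is [6q], [6q +- 1], [2(3q +- 1)] or [3(2q + 1)]
    with [q < n] and [6q <= n + 2], so six more ones suffice to pass from [q] to
    [n]. Since [6q <= n + 2] gives [6(5q - 2) <= 5n - 2], induction yields an
    expression with [k] ones and [6^k <= (5n - 2)^6]; finally
    [6 log_6 5 < 5.4] because [5^10 < 6^9]. *)

(** * Cubes of values against powers of 3 *)

Lemma pow3_ones_ge3 (e : expr) : (3 <= 3 ^ Z.of_nat (ones e))%Z.
Proof.
assert (H : (1 <= ones e)%nat) by (induction e; simpl; lia).
change 3%Z with (3 ^ 1)%Z at 1.
apply Z.pow_le_mono_r; lia.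
Qed.

(* The sum of [x, y >= 2] is at most their product, so only the cases where
   [x] or [y] is [0] or [1] need the exact bounds on [P] and [Q]. *)
Lemma cube_add_le (x y P Q : Z) :
  (0 <= x -> 0 <= y -> 3 <= P -> 3 <= Q ->
   (P < 9 -> P = 3) -> (Q < 9 -> Q = 3) ->
   x ^ 3 <= P -> y ^ 3 <= Q -> (x + y) ^ 3 <= P * Q)%Z.
Proof.
revert x y P Q.
assert (small : forall x y P Q,
  (0 <= x -> 0 <= y <= 1 -> 3 <= P -> 3 <= Q -> (P < 9 -> P = 3) ->
   x ^ 3 <= P -> (x + y) ^ 3 <= P * Q)%Z).
{ intros x y P Q hx hy hP hQ hP9 hxP.
  assert (h : (P * 3 <= P * Q)%Z) by nia.
  (* The worst case is [y = 1] with [Q = 3]. *)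
  enough ((x + 1) ^ 3 <= P * 3)%Z.
  { assert ((x + y) ^ 3 <= (x + 1) ^ 3)%Z by (apply Z.pow_le_mono_l; lia). lia. }
  (* At [x = 2] the gap hypothesis is essential: [8 <= P] forces [9 <= P], just enough for
     [27 <= 3 * P]. For [x >= 3], already [(x + 1)^3 <= 3 * x^3]. *)
  assert (c : (x = 0 \/ x = 1 \/ x = 2 \/ 3 <= x)%Z) by lia.
  destruct c as [->|[->|[->|c]]]; try lia.
  replace ((x + 1) ^ 3)%Z with (x ^ 3 + 3 * x * x + 3 * x + 1)%Z by ring.
  replace (x ^ 3)%Z with (x * x * x)%Z in * by ring. nia. }
intros x y P Q hx hy hP hQ hP9 hQ9 hxP hyQ.
destruct (Z_le_gt_dec y 1) as [h|h]; [apply small; lia|].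
destruct (Z_le_gt_dec x 1) as [h'|h'].
{ rewrite Z.add_comm, Z.mul_comm. apply small; lia. }
assert (h0 : (x + y <= x * y)%Z) by nia.
apply Z.le_trans with ((x * y) ^ 3)%Z.
- apply Z.pow_le_mono_l. lia.
- rewrite Z.pow_mul_l. apply Z.mul_le_mono_nonneg; auto; apply Z.pow_nonneg; lia.
Qed.

(** Induction on [e]. Absolute values let subtraction be treated like addition, by the triangle
    inequality; products multiply the bounds. *)
Lemma abs_eval_cube_le (e : expr) :
  (Z.abs (eval e) ^ 3 <= 3 ^ Z.of_nat (ones e))%Z.
Proof.
assert (gap : forall e, (3 ^ Z.of_nat (ones e) < 9 -> 3 ^ Z.of_nat (ones e) = 3)%Z).
{ intros a h. pose proof (pow3_ones_ge3 a) as h3.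
  destruct (ones a) as [|[|k]]; [simpl in h3; lia|reflexivity|].
  assert (3 ^ 2 <= 3 ^ Z.of_nat (S (S k)))%Z by (apply Z.pow_le_mono_r; lia). lia. }
(* Here [z] stands for the absolute value of either the sum or the difference. *)
assert (add : forall a b z, (z <= Z.abs (eval a) + Z.abs (eval b) -> 0 <= z ->
   Z.abs (eval a) ^ 3 <= 3 ^ Z.of_nat (ones a) ->
   Z.abs (eval b) ^ 3 <= 3 ^ Z.of_nat (ones b) ->
   z ^ 3 <= 3 ^ Z.of_nat (ones a + ones b))%Z).
{ intros a b z hz hz0 ha hb.
  rewrite Nat2Z.inj_add, Z.pow_add_r by lia.
  apply Z.le_trans with ((Z.abs (eval a) + Z.abs (eval b)) ^ 3)%Z.
  - apply Z.pow_le_mono_l. lia.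
  - apply cube_add_le; auto using pow3_ones_ge3, Z.abs_nonneg. }
induction e as [|a IHa b IHb|a IHa b IHb|a IHa b IHb].
- simpl. lia.
- simpl eval; simpl ones. apply add; auto; lia.
- simpl eval; simpl ones.
  rewrite Nat2Z.inj_add, Z.pow_add_r, Z.abs_mul, Z.pow_mul_l by lia.
  apply Z.mul_le_mono_nonneg; auto; apply Z.pow_nonneg; lia.
- simpl eval; simpl ones. apply add; auto; lia.
Qed.

(** * Powers of 3 *)

(** Induction on [k]: a factor 3 of [n] is cancelled; if there is none, [n] is coprime to 3 and
    Gauss's lemma lowers the exponent. *)
Lemma divide_pow3 (k : nat) (n : Z) :
  (0 < n)%Z -> (n | 3 ^ Z.of_nat k)%Z -> exists j : nat, n = (3 ^ Z.of_nat j)%Z.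
Proof.
revert n. induction k as [|k IH]; intros n hn hd.
- exists 0%nat. apply Z.divide_1_r_nonneg in hd; [exact hd|lia].
- rewrite Nat2Z.inj_succ, Z.pow_succ_r in hd by lia.
  destruct (Zdivide_dec 3 n) as [[m hm]|h3].
  + destruct (IH m) as [j hj]; [lia| |].
    * apply (Z.mul_divide_cancel_l _ _ 3); [lia|].
      now rewrite (Z.mul_comm 3 m), <- hm.
    * exists (S j). rewrite Nat2Z.inj_succ, Z.pow_succ_r by lia. lia.
  + apply IH; [exact hn|].
    apply Gauss with 3%Z; [exact hd|].
    apply rel_prime_sym, prime_rel_prime; [exact prime_3|exact h3].
Qed.

(** A product of copies of [1 + 1 + 1]. Exponents start at 1, since the value 1 cannot be written
    with zero ones. *)
Lemma expr_pow3 (k : nat) :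
  exists e, eval e = (3 ^ Z.of_nat (S k))%Z /\ ones e = (3 * S k)%nat.
Proof.
induction k as [|k [e [hv ho]]].
- now exists (Add One (Add One One)).
- exists (Mul (Add One (Add One One)) e). split.
  + rewrite Nat2Z.inj_succ, Z.pow_succ_r, <- hv by lia. reflexivity.
  + simpl ones. lia.
Qed.

(** * Upper bound by division by 6 *)

(** The factors 2 and 3 cost five ones, and a single further one reaches every nonzero residue: for
    -2, 2 and 3 it is inserted between the two multiplications. *)
Lemma expr_base6_step (q r : Z) (e : expr) :
  eval e = q -> (-2 <= r <= 3)%Z ->
  exists e', eval e' = (6 * q + r)%Z /\ (ones e' <= ones e + 6)%nat.
Proof.
intros hq hr.
pose (two := Add One One). pose (three := Add One two).
assert (c : (r = -2 \/ r = -1 \/ r = 0 \/ r = 1 \/ r = 2 \/ r = 3)%Z) by lia.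
destruct c as [->|[->|[->|[->|[->| ->]]]]];
  [exists (Mul two (Sub (Mul three e) One))
  |exists (Sub (Mul two (Mul three e)) One)
  |exists (Mul two (Mul three e))
  |exists (Add (Mul two (Mul three e)) One)
  |exists (Mul two (Add (Mul three e) One))
  |exists (Mul three (Add (Mul two e) One))];
  cbn [two three eval ones]; split; lia.
Qed.

(** The shift by -2 makes the induction close: [q] may exceed [n / 6], and a bound by [(5 * n) ^ 6]
    would not absorb that excess. *)
Lemma expr_upper (n : Z) :
  (0 < n)%Z ->
  exists e, eval e = n /\ (6 ^ Z.of_nat (ones e) <= (5 * n - 2) ^ 6)%Z.
Proof.
intro hn.
assert (h0 : (0 <= n)%Z) by lia.
revert n h0 hn. apply (Z_lt_induction (fun n => (0 < n)%Z -> _)).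
intros n IH hn.
assert (c : (n = 1 \/ n = 2 \/ n = 3 \/ 4 <= n)%Z) by lia.
destruct c as [->|[->|[->|hn4]]].
- exists One. simpl. split; lia.
- exists (Add One One). simpl. split; lia.
- exists (Add One (Add One One)). simpl. split; lia.
(* This rounding puts [n - 6 * q] between -2 and 3, and [4 <= n] ensures [0 < q < n]. *)
- pose (q := ((n + 2) / 6)%Z).
  assert (hq : (6 * q <= n + 2 < 6 * q + 6)%Z).
  { unfold q. pose proof (Z.div_mod (n + 2) 6). pose proof (Z.mod_pos_bound (n + 2) 6).
    lia. }
  destruct (IH q) as [e [hv ho]]; [lia|lia|].
  destruct (expr_base6_step q (n - 6 * q) e hv) as [e' [hv' ho']]; [lia|].
  exists e'. split; [lia|].
  apply Z.le_trans with (6 ^ (Z.of_nat (ones e) + 6))%Z.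
  { apply Z.pow_le_mono_r; lia. }
  apply Z.le_trans with ((6 * (5 * q - 2)) ^ 6)%Z.
  + rewrite Z.pow_add_r, Z.pow_mul_l, Z.mul_comm by lia.
    apply Z.mul_le_mono_nonneg_l; [lia|exact ho].
  + apply Z.pow_le_mono_l. lia.
Qed.

(** * From integer powers to logarithms *)

Lemma ln_IZR_pow (a : Z) (p : nat) :
  (0 < a)%Z -> ln (IZR (a ^ Z.of_nat p)) = INR p * ln (IZR a).
Proof.
intro ha. rewrite <- pow_IZR. apply ln_pow. now apply IZR_lt.
Qed.

Lemma ln_lt_of_pow_lt (a b : Z) (p q : nat) :
  (0 < a)%Z -> (0 < b)%Z -> (a ^ Z.of_nat p < b ^ Z.of_nat q)%Z ->
  INR p * ln (IZR a) < INR q * ln (IZR b).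
Proof.
intros ha hb h. rewrite <- !ln_IZR_pow by assumption.
apply ln_increasing; [apply IZR_lt, Z.pow_pos_nonneg; lia|now apply IZR_lt].
Qed.

Lemma ln_le_of_pow_le (a b : Z) (p q : nat) :
  (0 < a)%Z -> (0 < b)%Z -> (a ^ Z.of_nat p <= b ^ Z.of_nat q)%Z ->
  INR p * ln (IZR a) <= INR q * ln (IZR b).
Proof.
intros ha hb h. destruct (Zle_lt_or_eq _ _ h) as [hlt|heq].
- now apply Rlt_le, ln_lt_of_pow_lt.
- rewrite <- !ln_IZR_pow, heq by assumption. apply Rle_refl.
Qed.

Lemma ln_IZR_pos (n : Z) : (1 < n)%Z -> 0 < ln (IZR n).
Proof.
intro hn. rewrite <- ln_1. apply ln_increasing; [lra|now apply IZR_lt].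
Qed.

(** * Bounds on the complexity *)

Lemma cube_le_pow3_complexity (n : Z) :
  (0 < n)%Z -> (n ^ 3 <= 3 ^ Z.of_nat (complexity n))%Z.
Proof.
intro hn. destruct (complexityP n) as [[e [hv ho]] _].
rewrite <- ho, <- (Z.abs_eq n), <- hv by lia.
apply abs_eval_cube_le.
Qed.

Lemma complexity_lower (n : Z) :
  (1 < n)%Z -> 3 * Rlog 3 (IZR n) <= INR (complexity n).
Proof.
intro hn. pose proof (ln_IZR_pos 3 eq_refl) as h3.
pose proof (ln_le_of_pow_le n 3 3 (complexity n)) as h.
rewrite (INR_IZR_INZ 3) in h. simpl Z.of_nat in h at 1.
unfold Rlog. apply Rmult_le_reg_r with (ln 3); [exact h3|].
replace (3 * (ln (IZR n) / ln 3) * ln 3) with (3 * ln (IZR n)) by (field; lra).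
apply h; [lia|lia|]. apply cube_le_pow3_complexity. lia.
Qed.

(** If the cube bound were an equality, [n] would divide a power of 3 and so be one itself. *)
Lemma complexity_lower_strict (n : Z) :
  (1 < n)%Z -> ~ (exists k : nat, n = (3 ^ Z.of_nat k)%Z) ->
  3 * Rlog 3 (IZR n) < INR (complexity n).
Proof.
intros hn hnp. pose proof (ln_IZR_pos 3 eq_refl) as h3.
pose proof (ln_lt_of_pow_lt n 3 3 (complexity n)) as h.
rewrite (INR_IZR_INZ 3) in h. simpl Z.of_nat in h at 1.
unfold Rlog. apply Rmult_lt_reg_r with (ln 3); [exact h3|].
replace (3 * (ln (IZR n) / ln 3) * ln 3) with (3 * ln (IZR n)) by (field; lra).
apply h; [lia|lia|].
destruct (Zle_lt_or_eq _ _ (cube_le_pow3_complexity n ltac:(lia))) as [hlt|heq];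
  [exact hlt|].
exfalso. apply hnp, (divide_pow3 (complexity n)); [lia|].
rewrite <- heq. exists (n ^ 2)%Z. ring.
Qed.

Lemma complexity_upper (n : Z) :
  (1 < n)%Z -> INR (complexity n) <= 6 * Rlog 6 (IZR n) + 5.890.
Proof.
intro hn. pose proof (ln_IZR_pos 6 eq_refl) as h6.
destruct (expr_upper n) as [e [hv ho]]; [lia|].
pose proof (proj2 (complexityP n) e hv) as hle.
(* The shift is dropped so that the logarithm splits into [ln 5 + ln n]. *)
assert (h : (6 ^ Z.of_nat (complexity n) <= (5 * n) ^ Z.of_nat 6)%Z).
{ apply Z.le_trans with (6 ^ Z.of_nat (ones e))%Z; [apply Z.pow_le_mono_r; lia|].
  apply Z.le_trans with (1 := ho). apply Z.pow_le_mono_l. lia. }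
apply ln_le_of_pow_le in h; [|lia|lia].
(* This yields [6 * ln 5 <= 5.4 * ln 6], within the allowed constant 5.890. *)
assert (h5 := ln_le_of_pow_le 5 6 10 9 eq_refl eq_refl ltac:(vm_compute; discriminate)).
rewrite mult_IZR, ln_mult in h; [|lra|apply IZR_lt; lia].
rewrite INR_IZR_INZ in h5. rewrite (INR_IZR_INZ 9) in h5.
rewrite (INR_IZR_INZ 6) in h. simpl Z.of_nat in h5, h.
unfold Rlog. apply Rmult_le_reg_r with (ln 6); [exact h6|].
replace ((6 * (ln (IZR n) / ln 6) + 5.890) * ln 6)
  with (6 * ln (IZR n) + 5.890 * ln 6) by (field; lra).
lra.
Qed.

Lemma Rlog6_lt_Rlog3 (n : Z) :
  (1 < n)%Z -> 6 * Rlog 6 (IZR n) < 3.679 * Rlog 3 (IZR n).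
Proof.
intro hn. pose proof (ln_IZR_pos 3 eq_refl) as h3.
pose proof (ln_IZR_pos 6 eq_refl) as h6. pose proof (ln_IZR_pos n hn) as hpos.
(* [233/380] lies between [log_6 3 = 0.613147...] and [3.679/6 = 0.613166...]. *)
assert (h := ln_lt_of_pow_lt 3 6 380 233 eq_refl eq_refl eq_refl).
rewrite INR_IZR_INZ in h. rewrite (INR_IZR_INZ 233) in h.
simpl Z.of_nat in h.
unfold Rlog. apply Rmult_lt_reg_r with (ln 3 * ln 6); [nra|].
replace (6 * (ln (IZR n) / ln 6) * (ln 3 * ln 6))
  with (ln (IZR n) * (6 * ln 3)) by (field; lra).
replace (3.679 * (ln (IZR n) / ln 3) * (ln 3 * ln 6))
  with (ln (IZR n) * (3.679 * ln 6)) by (field; lra).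
apply Rmult_lt_compat_l; [exact hpos|lra].
Qed.

Lemma complexity_pow3_le (k : nat) :
  (1 < 3 ^ Z.of_nat k)%Z ->
  INR (complexity (3 ^ Z.of_nat k)) <= 3 * Rlog 3 (IZR (3 ^ Z.of_nat k)).
Proof.
(* Exponent 0 gives the value 1, excluded by [hk]. *)
intro hk. destruct k as [|k]; [simpl in hk; lia|].
pose proof (ln_IZR_pos 3 eq_refl) as h3.
destruct (expr_pow3 k) as [e [hv ho]].
pose proof (proj2 (complexityP _) e hv) as hle.
unfold Rlog. rewrite ln_IZR_pow by lia.
replace (3 * (INR (S k) * ln 3 / ln 3)) with (INR 3 * INR (S k)).
- rewrite <- mult_INR, <- ho. now apply le_INR.
- rewrite (INR_IZR_INZ 3). simpl Z.of_nat. field. lra.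
Qed.

Theorem theorem2 (n : Z) (hn : (1 < n)%Z) :
  (3 * Rlog 3 (IZR n) <= INR (complexity n)
   /\ INR (complexity n) <= 6 * Rlog 6 (IZR n) + 5.890
   /\ 6 * Rlog 6 (IZR n) + 5.890 < 3.679 * Rlog 3 (IZR n) + 5.890)
  /\ ((exists k : nat, n = (3 ^ Z.of_nat k)%Z) ->
        INR (complexity n) = 3 * Rlog 3 (IZR n))
  /\ (~ (exists k : nat, n = (3 ^ Z.of_nat k)%Z) ->
        INR (complexity n) > 3 * Rlog 3 (IZR n)).
Proof.
split; [split; [|split]|split].
- now apply complexity_lower.
- now apply complexity_upper.
- apply Rplus_lt_compat_r. now apply Rlog6_lt_Rlog3.
- intros [k ->]. apply Rle_antisym.
  + now apply complexity_pow3_le.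
  + now apply complexity_lower.
- intro hnp. now apply complexity_lower_strict.
Qed.
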